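(* Let $X$ be a $\delta$-hyperbolic proper geodesic metric space with bounded growth at some scale. Then for any $\xi\in\partial X$, any $p\in X$ and any $0<\epsilon\le\epsilon_0$, the metric space $(\partial X\setminus\{\xi\},d_{\xi,p,\epsilon})$ is doubling.
   Context: $X$ has Gromov boundary $\partial X$. Busemann function: for a ray $\gamma$ from $p$ to $\xi$, $B_\gamma(x)=\lim_{t\to\infty}(d(\gamma(t),x)-t)$, $B_{\xi,p}=\sup_\gamma B_\gamma$ over rays from $p$ to $\xi$. For distinct $\eta_1,\eta_2\in\partial X\setminus\{\xi\}$, $H_{\xi,p}(\eta_1,\eta_2)=\inf_\sigma\inf_{x\in\sigma}B_{\xi,p}(x)$ over complete geodesics $\sigma$ from $\eta_1$ to $\eta_2$, and $D_{\xi,p,\epsilon}(\eta_1,\eta_2)=e^{-\epsilon H_{\xi,p}(\eta_1,\eta_2)}$. There is $\epsilon_0>0$ depending only on $\delta$ such that for $0<\epsilon\le\epsilon_0$ there exists a metric $d_{\xi,p,\epsilon}$ on $\partial X\setminus\{\xi\}$ with $\frac12D_{\xi,p,\epsilon}\le d_{\xi,p,\epsilon}\le D_{\xi,p,\epsilon}$ (a parabolic visual metric; any such metric is meant). A metric space has bounded growth at some scale if there are $R>r>0$ and an integer $N\ge1$ such that every open ball of radius $R$ can be covered by $N$ open balls of radius $r$. A metric space is doubling if there is $N$ such that every open ball of radius $R>0$ can be covered by at most $N$ open balls of radius $R/2$. *)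

(* Defs.v *)
From Stdlib Require Import Reals Lra List.
From Coquelicot Require Import Coquelicot.
Open Scope R_scope.

Section Defs.
Variables (X : Type) (d : X -> X -> R).

Definition is_metric : Prop :=
  (forall x y, 0 <= d x y) /\ (forall x y, d x y = 0 <-> x = y) /\
  (forall x y, d x y = d y x) /\ (forall x y z, d x z <= d x y + d y z).

Definition geodesic_space : Prop :=
  forall x y, exists g : R -> X, g 0 = x /\ g (d x y) = y /\
    forall s t, 0 <= s <= d x y -> 0 <= t <= d x y -> d (g s) (g t) = Rabs (s - t).

Definition proper_space : Prop :=
  forall (x : X) (r : R) (u : nat -> X), (forall n, d x (u n) <= r) ->
    exists (phi : nat -> nat) (l : X), (forall n, (phi n < phi (S n))%nat) /\
      forall e, 0 < e -> exists N, forall n, (N <= n)%nat -> d (u (phi n)) l < e.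

Definition gromov_product (w x y : X) : R := (d x w + d y w - d x y) / 2.
Definition hyperbolic (delta : R) : Prop :=
  forall w x y z, gromov_product w x y >= Rmin (gromov_product w x z) (gromov_product w z y) - delta.

Definition bounded_growth_some_scale : Prop :=
  exists (Rb r : R) (N : nat), 0 < r < Rb /\ (1 <= N)%nat /\
    forall x, exists l : list X, (length l <= N)%nat /\
      forall y, d x y < Rb -> exists c, In c l /\ d c y < r.

Definition is_ray (g : R -> X) : Prop :=
  forall s t, 0 <= s -> 0 <= t -> d (g s) (g t) = Rabs (s - t).
Definition asymptotic (g h : R -> X) : Prop :=
  exists C, (forall t, 0 <= t -> exists s, 0 <= s /\ d (g t) (h s) <= C) /\
            (forall t, 0 <= t -> exists s, 0 <= s /\ d (h t) (g s) <= C).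

Definition is_bpoint (B : (R -> X) -> Prop) : Prop :=
  exists g, is_ray g /\ forall h, B h <-> (is_ray h /\ asymptotic g h).
Definition boundary : Type := { B : (R -> X) -> Prop | is_bpoint B }.

Definition ray_from_to (p : X) (xi : boundary) (g : R -> X) : Prop :=
  is_ray g /\ g 0 = p /\ proj1_sig xi g.

Definition busemann (xi : boundary) (p : X) (x : X) : Rbar :=
  Lub_Rbar (fun b => exists g, ray_from_to p xi g /\
                      is_lim (fun t => d (g t) x - t) p_infty (Finite b)).

Definition is_line (s : R -> X) : Prop :=
  forall a b, d (s a) (s b) = Rabs (a - b).
Definition line_from_to (eta1 eta2 : boundary) (s : R -> X) : Prop :=
  is_line s /\ proj1_sig eta1 (fun t => s (- t)) /\ proj1_sig eta2 s.

Definition Hxp (xi : boundary) (p : X) (eta1 eta2 : boundary) : Rbar :=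
  Glb_Rbar (fun h => exists s t, line_from_to eta1 eta2 s /\
                               busemann xi p (s t) = Finite h).

Definition Dxpe (xi : boundary) (p : X) (eps : R) (eta1 eta2 : boundary) : Rbar :=
  match Hxp xi p eta1 eta2 with
  | Finite h => Finite (exp (- eps * h))
  | p_infty => Finite 0
  | m_infty => p_infty
  end.
End Defs.
Arguments is_metric {X} d.
Arguments geodesic_space {X} d.
Arguments proper_space {X} d.
Arguments gromov_product {X} d.
Arguments hyperbolic {X} d.
Arguments bounded_growth_some_scale {X} d.
Arguments is_ray {X} d.
Arguments asymptotic {X} d.
Arguments is_bpoint {X} d.
Arguments boundary {X} d.
Arguments ray_from_to {X} d.
Arguments busemann {X} d.
Arguments is_line {X} d.
Arguments line_from_to {X} d.
Arguments Hxp {X} d.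
Arguments Dxpe {X} d.

Definition punct_boundary {X} (d : X -> X -> R) (xi : boundary d) : Type :=
  { eta : boundary d | eta <> xi }.

Definition parabolic_visual_metric {X} (d : X -> X -> R) (xi : boundary d) (p : X)
  (eps : R) (dv : punct_boundary d xi -> punct_boundary d xi -> R) : Prop :=
  is_metric dv /\
  forall a b : punct_boundary d xi, a <> b ->
    Rbar_le (Rbar_mult (Finite (1/2)) (Dxpe d xi p eps (proj1_sig a) (proj1_sig b)))
            (Finite (dv a b)) /\
    Rbar_le (Finite (dv a b)) (Dxpe d xi p eps (proj1_sig a) (proj1_sig b)).

Definition doubling {T : Type} (dT : T -> T -> R) : Prop :=
  exists N : nat, forall (x : T) (r : R), 0 < r ->
    exists l : list T, (length l <= N)%nat /\
      forall y, dT x y < r -> exists c, In c l /\ dT c y < r / 2.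

(* Main.v *)
Require Import Defs.
From Stdlib Require Import Reals List Lra Lia Classical.
From Coquelicot Require Import Coquelicot.
Open Scope R_scope.

(** Fix one ray from [p] to [xi] and let [b] be its Busemann function. The
    Gromov product based at [xi], [<x|y> = (b x + b y - d x y) / 2], inherits
    the four-point inequality, and along a line [s] the infimum of [b] agrees up
    to a multiple of [delta] with the limit of [<s(-t)|s(t)>].

    Let [eta] lie in the ball of radius [rho = exp (- eps h)] about [eta0] but
    not in the ball of radius [rho / 2], and let [s] be a line from [eta0] to
    [eta]. A point [m] of [s] at which [b] is almost minimal has height [h] up to
    a constant, and all the points [m] so obtained lie at bounded distance from
    each other, since they lie near the line from [xi] to [eta0]. Let [x] be the
    point of [s] at distance [L] beyond [m] towards [eta]. If the points [x], [x']
    belonging to [eta], [eta'] are at distance at most [2 r], then every line from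
    [eta] to [eta'] stays above height [h + L - C], so [eta'] is within [rho / 2]
    of [eta] once the constant [L] is large. Bounded growth covers the
    points [x] by a bounded number of [r]-balls. *)

(** * Bounded growth: from one scale to every radius *)

Section Growth.
Variables (X : Type) (d : X -> X -> R).
Hypotheses (Hm : is_metric d) (Hgeo : geodesic_space d).

(** On a geodesic from [x] to a far point [y] there is a point at distance less than [Rb] from [x]
    and at most [s - r] from [y]. A centre within [r] of it is at distance less than [s] from [y],
    so covering the [s]-balls about the centres suffices. *)
Lemma cover_enlarge (r Rb s : R) (N M : nat) :
  0 < r < Rb -> Rb <= s ->
  (forall x, exists l : list X, (length l <= N)%nat /\
     forall y, d x y < Rb -> exists c, In c l /\ d c y < r) ->
  (forall x, exists l : list X, (length l <= M)%nat /\
     forall y, d x y < s -> exists c, In c l /\ d c y < r) ->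
  forall x, exists l : list X, (length l <= N * M)%nat /\
     forall y, d x y < s + (Rb - r) -> exists c, In c l /\ d c y < r.
Proof.
  destruct Hm as (Hpos & _ & Hsym & Htri).
  intros Hr Hs HN HM x.
  destruct (HN x) as (l & Hl & Hc).
  assert (Hall : exists l' : list X, (length l' <= length l * M)%nat /\
     forall c y, In c l -> d c y < s -> exists c', In c' l' /\ d c' y < r).
  { clear Hl Hc. induction l as [|a l (l' & Hl' & IH)].
    - exists nil. split; [simpl; lia | intros c y []].
    - destruct (HM a) as (la & Hla & Ha). exists (la ++ l'). split.
      + rewrite length_app. simpl. lia.
      + intros c y [<- | Hc] Hd.
        * destruct (Ha y Hd) as (c' & Hc' & Hd').
          exists c'. split; [apply in_or_app; now left | exact Hd'].
        * destruct (IH c y Hc Hd) as (c' & Hc' & Hd').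
          exists c'. split; [apply in_or_app; now right | exact Hd']. }
  destruct Hall as (l' & Hl' & H).
  exists l'. split.
  { apply Nat.le_trans with (1 := Hl'). apply Nat.mul_le_mono_r, Hl. }
  intros y Hy.
  destruct (Rlt_or_le (d x y) Rb) as [Hlt | Hge].
  - destruct (Hc y Hlt) as (c & Hin & Hd). apply (H c y Hin). lra.
  - destruct (Hgeo x y) as (g & Hg0 & Hg1 & Hg).
    set (u := Rmax 0 (Rmax (Rb - r) (d x y - (s - r)))).
    assert (Hu : 0 <= u /\ u < Rb /\ d x y - u <= s - r).
    { unfold u, Rmax; repeat destruct Rle_dec; lra. }
    assert (H1 : d x (g u) = u).
    { rewrite <- Hg0 at 1. rewrite Hg by lra. rewrite Rabs_left1; lra. }
    assert (H2 : d (g u) y = d x y - u).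
    { rewrite <- Hg1 at 1. rewrite Hg by lra. rewrite Rabs_left1; lra. }
    destruct (Hc (g u)) as (c & Hin & Hd); [lra|].
    apply (H c y Hin). specialize (Htri c (g u) y). lra.
Qed.

(** The small radius [r] stays fixed, and each use of [cover_enlarge] adds [Rb - r] to the large
    one. *)
Lemma bounded_growth_all_radii :
  bounded_growth_some_scale d ->
  exists r, 0 < r /\ forall s, exists N : nat, forall x, exists l : list X,
    (length l <= N)%nat /\ forall y, d x y < s -> exists c, In c l /\ d c y < r.
Proof.
  intros (Rb & r & N & Hr & HN & H).
  exists r. split; [lra|]. intros s.
  destruct (INR_unbounded (s / (Rb - r))) as (k & Hk).
  assert (Hs : s < Rb + INR k * (Rb - r)).
  { apply (Rmult_lt_compat_r (Rb - r)) in Hk; [|lra].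
    replace (s / (Rb - r) * (Rb - r)) with s in Hk by (field; lra). lra. }
  assert (Hall : exists M : nat, forall x, exists l : list X, (length l <= M)%nat /\
    forall y, d x y < Rb + INR k * (Rb - r) -> exists c, In c l /\ d c y < r).
  { clear Hk Hs. induction k as [|k (M & HM)].
    - exists N. intros x. destruct (H x) as (l & Hl & Hc).
      exists l. split; [exact Hl|]. intros y Hy. apply Hc. simpl in Hy. lra.
    - exists (N * M)%nat. intros x.
      assert (Hk := pos_INR k).
      destruct (cover_enlarge r Rb (Rb + INR k * (Rb - r)) N M Hr
                  ltac:(nra) H HM x) as (l & Hl & Hc).
      exists l. split; [exact Hl|]. intros y Hy. apply Hc.
      rewrite S_INR in Hy. lra. }
  destruct Hall as (M & HM). exists M. intros x.
  destruct (HM x) as (l & Hl & Hc). exists l. split; [exact Hl|].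
  intros y Hy. apply Hc. lra.
Qed.

End Growth.

(** * Gromov products based at a boundary point *)

Section Horofunction.
Variables (X : Type) (d : X -> X -> R) (b : X -> R) (delta : R).

(** For [b] the Busemann function of a ray [g], this is the limit of
    [gromov_product d (g t) x y - t]. *)
Definition horo_product (x y : X) : R := (b x + b y - d x y) / 2.

Hypotheses (Hm : is_metric d) (Hdelta : 0 <= delta)
  (Hlip : forall x y, b x <= b y + d x y)
  (Hhyp : forall M x y z, M <= horo_product x z -> M <= horo_product z y ->
     M - delta <= horo_product x y).

Lemma horo_product_sym (x y : X) : horo_product x y = horo_product y x.
Proof.
  destruct Hm as (_ & _ & Hsym & _). unfold horo_product. rewrite (Hsym x y). lra.
Qed.

(** Distances along a line add up, so the two Lipschitz errors cancel against [d (s a) (s c)]. *)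
Lemma horo_product_le_line (s : R -> X) (a u c : R) :
  is_line d s -> a <= u <= c -> horo_product (s a) (s c) <= b (s u).
Proof.
  intros Hs Hu. unfold horo_product.
  assert (H1 := Hlip (s a) (s u)). assert (H2 := Hlip (s c) (s u)).
  rewrite Hs, Rabs_left1 in H1 by lra. rewrite Hs, Rabs_pos_eq in H2 by lra.
  rewrite Hs, Rabs_left1 by lra. lra.
Qed.

(* The point [z] is the centre of the ideal triangle with vertices [s a], [s c]
   and [xi]: it is placed so that [<s a|z> = <z|s c>]. *)
Lemma horo_product_ge_line (s : R -> X) (A a c : R) :
  is_line d s -> (forall u, A <= b (s u)) -> a <= c ->
  A - 2 * delta <= horo_product (s a) (s c).
Proof.
  intros Hs HA Hac.
  set (u := (b (s a) - b (s c) + (c - a)) / 2).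
  assert (H1 := Hlip (s a) (s c)). assert (H2 := Hlip (s c) (s a)).
  rewrite Hs, Rabs_left1 in H1 by lra. rewrite Hs, Rabs_pos_eq in H2 by lra.
  assert (Hz := HA (a + u)).
  (* Both products with [z = s (a + u)] equal this value. With [P] the product of [s a] and [s c],
     the four-point inequality reads [(b z + P) / 2 - delta <= P]. *)
  assert (H := Hhyp ((b (s (a + u)) + horo_product (s a) (s c)) / 2)
    (s a) (s c) (s (a + u))).
  revert H. unfold horo_product. rewrite !Hs.
  rewrite (Rabs_left1 (a - (a + u))), (Rabs_left1 (a + u - c)), (Rabs_left1 (a - c))
    by (unfold u; lra).
  intros H. unfold u in *. lra.
Qed.

(** The product of [s t] with its mirror image [s (2 * t0 - t)] is bounded below, while the
    Lipschitz bound from [s t0] keeps [b] from being large at the image. *)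
Lemma line_growth (s : R -> X) (A k t0 t : R) :
  is_line d s -> (forall u, A <= b (s u)) -> b (s t0) <= A + k ->
  A - 4 * delta - k + Rabs (t - t0) <= b (s t).
Proof.
  intros Hs HA H0.
  assert (H1 := Hlip (s (2 * t0 - t)) (s t0)). rewrite Hs in H1.
  destruct (Rle_or_lt t0 t) as [Ht | Ht].
  - assert (H := horo_product_ge_line s A (2 * t0 - t) t Hs HA ltac:(lra)).
    unfold horo_product in H. rewrite Hs, Rabs_left1 in H by lra.
    rewrite Rabs_left1 in H1 by lra. rewrite Rabs_pos_eq by lra. lra.
  - assert (H := horo_product_ge_line s A t (2 * t0 - t) Hs HA ltac:(lra)).
    unfold horo_product in H. rewrite Hs, Rabs_left1 in H by lra.
    rewrite Rabs_pos_eq in H1 by lra. rewrite Rabs_left1 by lra. lra.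
Qed.

(** Growth of [b] at unit rate compensates the distance between the two points, so the bound is
    uniform in [t] and persists up to the end of [s]. *)
Lemma horo_product_line_end (s : R -> X) (A k t0 L t : R) :
  is_line d s -> (forall u, A <= b (s u)) -> b (s t0) <= A + k ->
  0 <= L -> t0 + L <= t ->
  A + L - 4 * delta - k <= horo_product (s (t0 + L)) (s t).
Proof.
  intros Hs HA H0 HL Ht.
  assert (H1 := line_growth s A k t0 (t0 + L) Hs HA H0).
  assert (H2 := line_growth s A k t0 t Hs HA H0).
  rewrite Rabs_pos_eq in H1, H2 by lra.
  unfold horo_product. rewrite Hs, Rabs_left1 by lra. lra.
Qed.

(** Along [g] the height grows linearly while the distance to [h] stays bounded. The bounds on [t]
    and [s] let both points be taken beyond any given parameter. *)
Lemma asymptotic_horo_product (g h : R -> X) (A M : R) :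
  is_ray d g -> is_ray d h -> asymptotic d g h ->
  (forall t, 0 <= t -> t - A <= b (g t)) ->
  exists t s, M <= t /\ M <= s /\ M <= horo_product (g t) (h s).
Proof.
  destruct Hm as (Hpos & _ & Hsym & Htri).
  intros Hg Hh (C & HC & _) HA.
  (* The product is at least [t - A - C], and [s] is at least [t - C - d (g 0) (h 0)]. *)
  set (t := Rabs M + Rabs A + Rabs C + d (g 0) (h 0)).
  assert (HM := Rle_abs M). assert (HA' := Rle_abs A). assert (HC' := Rle_abs C).
  assert (HM0 := Rabs_pos M). assert (HA0 := Rabs_pos A). assert (HC0 := Rabs_pos C).
  assert (Hd0 := Hpos (g 0) (h 0)).
  assert (Ht : 0 <= t) by (unfold t; lra).
  destruct (HC t Ht) as (s & Hs & Hd).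
  exists t, s. repeat split.
  - unfold t; lra.
  - assert (H1 := Htri (g 0) (h 0) (g t)). assert (H2 := Htri (h 0) (h s) (g t)).
    rewrite (Hsym (h s)) in H2.
    rewrite Hg, Rabs_left1 in H1 by lra. rewrite Hh, Rabs_left1 in H2 by lra.
    unfold t in *; lra.
  - assert (H1 := HA t Ht). assert (H2 := Hlip (g t) (h s)).
    unfold horo_product, t in *; lra.
Qed.

Lemma line_reverse (s : R -> X) : is_line d s -> is_line d (fun t => s (- t)).
Proof.
  intros Hs u v. rewrite Hs, <- Rabs_Ropp. f_equal. lra.
Qed.

Lemma line_ray (s : R -> X) : is_line d s -> is_ray d s.
Proof. intros Hs u v _ _. apply Hs. Qed.

(** In the chain [s t0], [s t], [s' t'], [s' t0'], with the middle points far out towards the common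
    end, consecutive products are at least [M - 4 * delta - k]. Two uses of the four-point
    inequality cost [2 * delta]. *)
Lemma horo_product_near_min (s s' : R -> X) (A A' M k t0 t0' : R) :
  is_line d s -> is_line d s' -> asymptotic d s s' ->
  (forall u, A <= b (s u)) -> b (s t0) <= A + k ->
  (forall u, A' <= b (s' u)) -> b (s' t0') <= A' + k ->
  M <= A -> M <= A' ->
  M - 6 * delta - k <= horo_product (s t0) (s' t0').
Proof.
  intros Hs Hs' Has HA H0 HA' H0' HM HM'.
  assert (Hk : 0 <= k) by (specialize (HA t0); lra).
  (* By [line_growth], [b (s t)] is at least [t] minus this constant. *)
  destruct (asymptotic_horo_product s s' (t0 - (A - 4 * delta - k))
    (Rmax (Rmax t0 t0') M) (line_ray s Hs) (line_ray s' Hs') Has)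
    as (t & t' & Ht & Ht' & Hp).
  { intros t _. assert (H := line_growth s A k t0 t Hs HA H0).
    assert (H' := Rle_abs (t - t0)). lra. }
  assert (H1 := Rmax_l (Rmax t0 t0') M). assert (H2 := Rmax_r (Rmax t0 t0') M).
  assert (H3 := Rmax_l t0 t0'). assert (H4 := Rmax_r t0 t0').
  assert (E := horo_product_line_end s A k t0 0 t Hs HA H0 ltac:(lra) ltac:(lra)).
  assert (E' := horo_product_line_end s' A' k t0' 0 t' Hs' HA' H0'
    ltac:(lra) ltac:(lra)).
  rewrite !Rplus_0_r in E, E'. rewrite horo_product_sym in E'.
  assert (F := Hhyp (M - 4 * delta - k) (s t0) (s' t') (s t) ltac:(lra) ltac:(lra)).
  assert (G := Hhyp (M - 5 * delta - k) (s t0) (s' t0') (s' t')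
    ltac:(lra) ltac:(lra)).
  lra.
Qed.

(** The chain is [w (- v)], [s t], [s (t0 + L)], [s' (t0' + L)], [s' t'], [w v']: its consecutive
    products are at least [P], and the product of its two ends bounds [b] from below on [w] between
    them. *)
Lemma line_between_high (s s' w : R -> X) (A A' M k t0 t0' L r : R) :
  is_line d s -> is_line d s' -> is_line d w ->
  asymptotic d s (fun t => w (- t)) -> asymptotic d s' w ->
  (forall u, A <= b (s u)) -> b (s t0) <= A + k ->
  (forall u, A' <= b (s' u)) -> b (s' t0') <= A' + k ->
  M <= A -> M <= A' -> 0 <= L -> 0 <= r ->
  d (s (t0 + L)) (s' (t0' + L)) <= 2 * r ->
  forall u, M + L - 7 * delta - k - r <= b (w u).
Proof.
  intros Hs Hs' Hw Has Has' HA H0 HA' H0' HM HM' HL Hr Hd u.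
  set (P := M + L - 4 * delta - k - r).
  (* The entry [Rabs u] makes [- v <= u <= v']. *)
  set (Q := Rmax (Rmax (t0 + L) (t0' + L)) (Rmax P (Rabs u))).
  assert (HQ : t0 + L <= Q /\ t0' + L <= Q /\ P <= Q /\ Rabs u <= Q).
  { unfold Q; repeat split;
      [ apply Rle_trans with (2 := Rmax_l _ _); apply Rmax_l
      | apply Rle_trans with (2 := Rmax_l _ _); apply Rmax_r
      | apply Rle_trans with (2 := Rmax_r _ _); apply Rmax_l
      | apply Rle_trans with (2 := Rmax_r _ _); apply Rmax_r ]. }
  assert (Hu := Rle_abs u). assert (Hu' := Rle_abs (- u)). rewrite Rabs_Ropp in Hu'.
  destruct (asymptotic_horo_product s _ (t0 - (A - 4 * delta - k)) Q
    (line_ray _ Hs) (line_ray _ (line_reverse _ Hw)) Has)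
    as (t & v & Ht & Hv & Hp).
  { intros t _. assert (H := line_growth s A k t0 t Hs HA H0).
    assert (H' := Rle_abs (t - t0)). lra. }
  destruct (asymptotic_horo_product s' _ (t0' - (A' - 4 * delta - k)) Q
    (line_ray _ Hs') (line_ray _ Hw) Has')
    as (t' & v' & Ht' & Hv' & Hp').
  { intros t' _. assert (H := line_growth s' A' k t0' t' Hs' HA' H0').
    assert (H' := Rle_abs (t' - t0')). lra. }
  assert (E := horo_product_line_end s A k t0 L t Hs HA H0 HL ltac:(lra)).
  assert (E' := horo_product_line_end s' A' k t0' L t' Hs' HA' H0' HL ltac:(lra)).
  assert (Hx := line_growth s A k t0 (t0 + L) Hs HA H0).
  assert (Hx' := line_growth s' A' k t0' (t0' + L) Hs' HA' H0').
  rewrite Rabs_pos_eq in Hx, Hx' by lra.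
  assert (Exx : P <= horo_product (s (t0 + L)) (s' (t0' + L)))
    by (unfold P, horo_product; lra).
  rewrite horo_product_sym in E, Hp.
  (* Shortening both ends of the chain first makes four uses of the inequality cost only
     [3 * delta]. *)
  assert (F1 := Hhyp P (w (- v)) (s (t0 + L)) (s t) ltac:(lra) ltac:(unfold P; lra)).
  assert (F2 := Hhyp P (s' (t0' + L)) (w v') (s' t') ltac:(unfold P; lra) ltac:(lra)).
  assert (F3 := Hhyp (P - delta) (w (- v)) (s' (t0' + L)) (s (t0 + L))
    ltac:(lra) ltac:(lra)).
  assert (F4 := Hhyp (P - 2 * delta) (w (- v)) (w v') (s' (t0' + L))
    ltac:(lra) ltac:(lra)).
  assert (F5 := horo_product_le_line w (- v) u v' Hw ltac:(lra)).
  unfold P in *. lra.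
Qed.

End Horofunction.

(** * Busemann functions of single rays, and their supremum *)

Section Busemann.
Variables (X : Type) (d : X -> X -> R) (delta : R).
Hypotheses (Hm : is_metric d) (Hhyp : hyperbolic d delta).

(** Four equal points; [x] witnesses that [X] is nonempty. *)
Lemma hyperbolic_nonneg (x : X) : 0 <= delta.
Proof.
  destruct Hm as (_ & Hid & _ & _).
  assert (H := Hhyp x x x x). unfold gromov_product in H.
  rewrite (proj2 (Hid x x) eq_refl) in H.
  unfold Rmin in H. destruct Rle_dec; lra.
Qed.

(** [Lim] and [real] are total; [ray_busemann_spec] shows that for a ray this is a genuine finite
    limit. *)
Definition ray_busemann (g : R -> X) (x : X) : R :=
  real (Lim (fun t => d (g t) x - t) p_infty).

(** The limit is the infimum, obtained as the supremum of the lower bounds. *)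
Lemma nonincreasing_lim (f : R -> R) (m : R) :
  (forall s t, 0 <= s <= t -> f t <= f s) -> (forall t, 0 <= t -> m <= f t) ->
  exists l : R, is_lim f p_infty l /\ forall t, 0 <= t -> l <= f t.
Proof.
  intros Hf Hlow.
  destruct (completeness (fun y => forall t, 0 <= t -> y <= f t)) as (l & Hub & Hl).
  - exists (f 0). intros y Hy. apply Hy. lra.
  - exists m. exact Hlow.
  - assert (Hle : forall t, 0 <= t -> l <= f t).
    { intros t Ht. apply Hl. intros y Hy. now apply Hy. }
    exists l. split; [|exact Hle].
    apply is_lim_spec. intros e.
    assert (He := cond_pos e).
    assert (Hex : exists t, 0 <= t /\ f t < l + e).
    { apply NNPP. intros Hn.
      assert (l + e <= l); [|lra].
      apply Hub. intros t Ht. apply Rnot_lt_le. intros Hlt.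
      apply Hn. now exists t. }
    destruct Hex as (t & Ht & Hlt). exists t. intros y Hy.
    assert (H1 := Hf t y ltac:(lra)). assert (H2 := Hle y ltac:(lra)).
    rewrite Rabs_pos_eq; lra.
Qed.

Lemma ray_busemann_spec (g : R -> X) (x : X) :
  is_ray d g ->
  is_lim (fun t => d (g t) x - t) p_infty (ray_busemann g x) /\
  forall t, 0 <= t -> ray_busemann g x <= d (g t) x - t.
Proof.
  destruct Hm as (_ & _ & Hsym & Htri). intros Hg.
  destruct (nonincreasing_lim (fun t => d (g t) x - t) (- d (g 0) x))
    as (l & Hl & Hle).
  - intros s t Hst. assert (H := Htri (g t) (g s) x).
    rewrite Hg, Rabs_pos_eq in H by lra. lra.
  - intros t Ht. assert (H := Htri (g 0) x (g t)).
    rewrite Hg, Rabs_left1, (Hsym x) in H by lra. lra.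
  - unfold ray_busemann. rewrite (is_lim_unique _ _ _ Hl). split; assumption.
Qed.

Lemma ray_busemann_approx (g : R -> X) (x : X) (e : R) :
  is_ray d g -> 0 < e ->
  exists T, forall t, T < t -> 0 <= t ->
    ray_busemann g x <= d (g t) x - t < ray_busemann g x + e.
Proof.
  intros Hg He. destruct (ray_busemann_spec g x Hg) as (Hl & Hle).
  apply is_lim_spec in Hl. destruct (Hl (mkposreal e He)) as (T & HT).
  exists T. intros t Ht H0. specialize (HT t Ht). specialize (Hle t H0).
  apply Rabs_def2 in HT. simpl in HT. lra.
Qed.

Lemma ray_busemann_lipschitz (g : R -> X) (x y : X) :
  is_ray d g -> ray_busemann g x <= ray_busemann g y + d x y.
Proof.
  destruct Hm as (_ & _ & Hsym & Htri). intros Hg.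
  apply le_epsilon. intros e He.
  destruct (ray_busemann_approx g x e Hg He) as (T & HT).
  destruct (ray_busemann_approx g y e Hg He) as (T' & HT').
  set (t := Rabs T + Rabs T' + 1).
  assert (Ht : 0 <= t /\ T < t /\ T' < t).
  { assert (H1 := Rle_abs T). assert (H2 := Rle_abs T').
    assert (H3 := Rabs_pos T). assert (H4 := Rabs_pos T'). unfold t; lra. }
  specialize (HT t ltac:(lra) ltac:(lra)). specialize (HT' t ltac:(lra) ltac:(lra)).
  assert (H := Htri (g t) y x). rewrite (Hsym y x) in H. lra.
Qed.

(** Limit of the four-point inequality based at [g t], after subtracting [t] from every product. *)
Lemma ray_busemann_hyperbolic (g : R -> X) (M : R) (x y z : X) :
  is_ray d g ->
  M <= horo_product X d (ray_busemann g) x z ->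
  M <= horo_product X d (ray_busemann g) z y ->
  M - delta <= horo_product X d (ray_busemann g) x y.
Proof.
  destruct Hm as (_ & _ & Hsym & _). intros Hg Hxz Hzy.
  apply le_epsilon. intros e He.
  destruct (ray_busemann_approx g x e Hg He) as (T & HT).
  destruct (ray_busemann_approx g y e Hg He) as (T' & HT').
  destruct (ray_busemann_approx g z e Hg He) as (T'' & HT'').
  set (t := Rabs T + Rabs T' + Rabs T'' + 1).
  assert (Ht : 0 <= t /\ T < t /\ T' < t /\ T'' < t).
  { assert (H1 := Rle_abs T). assert (H2 := Rle_abs T'). assert (H3 := Rle_abs T'').
    assert (H4 := Rabs_pos T). assert (H5 := Rabs_pos T').
    assert (H6 := Rabs_pos T''). unfold t; lra. }
  specialize (HT t ltac:(lra) ltac:(lra)). specialize (HT' t ltac:(lra) ltac:(lra)).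
  specialize (HT'' t ltac:(lra) ltac:(lra)).
  assert (H := Hhyp (g t) x y z).
  unfold horo_product, gromov_product in *.
  rewrite (Hsym x (g t)), (Hsym y (g t)), (Hsym z (g t)) in H.
  unfold Rmin in H. destruct Rle_dec; lra.
Qed.

Lemma boundary_asymptotic (xi : boundary d) (g h : R -> X) :
  proj1_sig xi g -> proj1_sig xi h -> asymptotic d g h.
Proof.
  destruct Hm as (_ & _ & _ & Htri).
  destruct xi as (B & g0 & Hg0 & HB); simpl. intros Hg Hh.
  apply HB in Hg. apply HB in Hh.
  destruct Hg as (_ & C & HC1 & HC2). destruct Hh as (_ & C' & HC1' & HC2').
  exists (C + C'). split; intros t Ht.
  - destruct (HC2 t Ht) as (s & Hs & Hd). destruct (HC1' s Hs) as (s' & Hs' & Hd').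
    exists s'. split; [exact Hs'|]. specialize (Htri (g t) (g0 s) (h s')). lra.
  - destruct (HC2' t Ht) as (s & Hs & Hd). destruct (HC1 s Hs) as (s' & Hs' & Hd').
    exists s'. split; [exact Hs'|]. specialize (Htri (h t) (g0 s) (g s')). lra.
Qed.

(** From the common origin, the consecutive products of [g t], [g (t + c)], [h s], [h t] are at
    least [t]. Hence the product of [g t] and [h t] is at least [t - 2 * delta]. *)
Lemma asymptotic_rays_close (g h : R -> X) (t : R) :
  is_ray d g -> is_ray d h -> g 0 = h 0 -> asymptotic d g h -> 0 <= t ->
  d (g t) (h t) <= 4 * delta.
Proof.
  assert (Hd0 := hyperbolic_nonneg (g 0)).
  destruct Hm as (Hpos & _ & Hsym & Htri).
  intros Hg Hh H0 (C & HC & _) Ht.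
  assert (HCa := Rle_abs C). assert (HC0 := Rabs_pos C).
  revert HCa HC0. generalize (Rabs C) as c. intros c HCa HC0.
  destruct (HC (t + c)) as (s & Hs & Hd); [lra|].
  assert (Hst : t + c <= s + C).
  { assert (H := Htri (h 0) (h s) (g (t + c))).
    rewrite (Hsym (h s)), <- H0, Hg, H0, Hh, 2!Rabs_left1 in H by lra. lra. }
  assert (H1 := Hhyp (g 0) (g t) (h s) (g (t + c))).
  assert (H2 := Hhyp (g 0) (g t) (h t) (h s)).
  unfold gromov_product in *. rewrite !Hg in H1 by lra. rewrite Hg in H2 by lra.
  rewrite !H0 in H1. rewrite !H0 in H2.
  rewrite !Hh in H1 by lra. rewrite !Hh in H2 by lra.
  rewrite (Rabs_left1 (t - (t + c))) in H1 by lra.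
  rewrite !(Rabs_pos_eq (_ - 0)) in H1 by lra.
  rewrite !(Rabs_pos_eq (_ - 0)) in H2 by lra.
  rewrite (Rabs_pos_eq (s - t)) in H2 by lra.
  unfold Rmin in *. repeat destruct Rle_dec; lra.
Qed.

(** Rays from [p] to [xi] are uniformly close, so the supremum over all of them is finite and one
    fixed ray can replace it at the cost of [4 * delta]. *)
Lemma busemann_bounds (xi : boundary d) (p x : X) (g : R -> X) :
  ray_from_to d p xi g ->
  exists B : R, busemann d xi p x = Finite B /\
    ray_busemann g x <= B <= ray_busemann g x + 4 * delta.
Proof.
  assert (Hm' := Hm). destruct Hm' as (_ & _ & Hsym & Htri).
  intros (Hg & Hg0 & Hgx).
  unfold busemann.
  match goal with |- context [Lub_Rbar ?E] =>
    destruct (Lub_Rbar_correct E) as (Hub & Hl) end.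
  assert (H1 := Hub (ray_busemann g x)
    (ex_intro _ g (conj (conj Hg (conj Hg0 Hgx)) (proj1 (ray_busemann_spec g x Hg))))).
  assert (H2 := Hl (Finite (ray_busemann g x + 4 * delta))).
  match type of H2 with ?P -> _ => assert (H3 : P) end.
  { intros c (h & (Hh & Hh0 & Hhx) & Hc). simpl.
    assert (Hc' : ray_busemann h x = c).
    { unfold ray_busemann. now rewrite (is_lim_unique _ _ _ Hc). }
    rewrite <- Hc'. apply le_epsilon. intros e He.
    destruct (ray_busemann_approx g x e Hg He) as (T & HT).
    assert (HTa := Rle_abs T). assert (HT0 := Rabs_pos T).
    specialize (HT (Rabs T + 1) ltac:(lra) ltac:(lra)).
    destruct (ray_busemann_spec h x Hh) as (_ & Hle).
    specialize (Hle (Rabs T + 1) ltac:(lra)).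
    assert (Hcl := asymptotic_rays_close h g (Rabs T + 1) Hh Hg
      (eq_trans Hh0 (eq_sym Hg0)) (boundary_asymptotic xi h g Hhx Hgx) ltac:(lra)).
    specialize (Htri (h (Rabs T + 1)) (g (Rabs T + 1)) x). lra. }
  specialize (H2 H3).
  destruct (Lub_Rbar _) as [B | |]; simpl in H1, H2; [|contradiction|contradiction].
  exists B. split; [reflexivity | lra].
Qed.

End Busemann.

(** * Finiteness of the heights and the lines and rays it provides *)

(** Height [p_infty] would make the distance of distinct points zero, and [m_infty] would make it
    infinite. *)
Lemma visual_metric_Hxp {X : Type} (d : X -> X -> R) (xi : boundary d) (p : X)
  (eps : R) (dv : punct_boundary d xi -> punct_boundary d xi -> R)
  (a c : punct_boundary d xi) :
  parabolic_visual_metric d xi p eps dv -> a <> c ->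
  exists H : R, Hxp d xi p (proj1_sig a) (proj1_sig c) = Finite H /\
    exp (- eps * H) / 2 <= dv a c <= exp (- eps * H).
Proof.
  intros ((Hpos & Hid & _) & HD) Hac.
  destruct (HD a c Hac) as (H1 & H2). unfold Dxpe in H1, H2.
  destruct (Hxp d xi p (proj1_sig a) (proj1_sig c)) as [H | |].
  - exists H. split; [reflexivity|]. simpl in H1, H2. lra.
  - simpl in H2. exfalso. apply Hac, Hid. specialize (Hpos a c). lra.
  - exfalso. revert H1. unfold Rbar_mult, Rbar_mult'.
    destruct Rle_dec as [Hle|]; [|lra].
    destruct Rle_lt_or_eq_dec; [intros [] | lra].
Qed.

(** A finite infimum is not over the empty set, so this also supplies a line between the two
    boundary points. *)
Lemma Hxp_near_min {X : Type} (d : X -> X -> R) (xi : boundary d) (p : X)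
  (eta eta' : boundary d) (H e : R) :
  Hxp d xi p eta eta' = Finite H -> 0 < e ->
  exists s t B, line_from_to d eta eta' s /\
    busemann d xi p (s t) = Finite B /\ B < H + e.
Proof.
  unfold Hxp. intros HH He. apply NNPP. intros Hn.
  match type of HH with Glb_Rbar ?E = _ =>
    destruct (Glb_Rbar_correct E) as (_ & Hglb) end.
  rewrite HH in Hglb.
  assert (Hb : Rbar_le (Finite (H + e)) (Finite H)); [|simpl in Hb; lra].
  apply Hglb. intros B (s & t & Hs & HB). simpl.
  apply Rnot_lt_le. intros Hlt. apply Hn. now exists s, t, B.
Qed.

Lemma Hxp_ge {X : Type} (d : X -> X -> R) (xi : boundary d) (p : X)
  (eta eta' : boundary d) (H m : R) :
  Hxp d xi p eta eta' = Finite H ->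
  (forall s t B, line_from_to d eta eta' s -> busemann d xi p (s t) = Finite B ->
     m <= B) ->
  m <= H.
Proof.
  unfold Hxp. intros HH Hlow.
  match type of HH with Glb_Rbar ?E = _ =>
    destruct (Glb_Rbar_correct E) as (_ & Hglb) end.
  rewrite HH in Hglb. apply (Hglb (Finite m)).
  intros B (s & t & Hs & HB). exact (Hlow s t B Hs HB).
Qed.

Lemma Hxp_le {X : Type} (d : X -> X -> R) (xi : boundary d) (p : X)
  (eta eta' : boundary d) (H B t : R) (s : R -> X) :
  Hxp d xi p eta eta' = Finite H -> line_from_to d eta eta' s ->
  busemann d xi p (s t) = Finite B -> H <= B.
Proof.
  unfold Hxp. intros HH Hs HB.
  match type of HH with Glb_Rbar ?E = _ =>
    destruct (Glb_Rbar_correct E) as (Hlb & _) end.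
  rewrite HH in Hlb. apply (Hlb B). now exists s, t.
Qed.

(** The supremum of the empty set is [m_infty]. *)
Lemma busemann_finite_ray {X : Type} (d : X -> X -> R) (xi : boundary d) (p x : X)
  (B : R) :
  busemann d xi p x = Finite B -> exists g, ray_from_to d p xi g.
Proof.
  unfold busemann. intros HB. apply NNPP. intros Hn.
  match type of HB with Lub_Rbar ?E = _ =>
    destruct (Lub_Rbar_correct E) as (_ & Hlub) end.
  rewrite HB in Hlub. apply (Hlub m_infty).
  intros c (g & Hg & _). apply Hn. now exists g.
Qed.

(** Serves to turn the centres of a cover in [X] into centres in the boundary, one for each ball
    that is met. *)
Lemma select_witnesses {S T : Type} (Q : S -> T -> Prop) (l : list S) :
  exists l' : list T, (length l' <= length l)%nat /\
    forall c t, In c l -> Q c t -> exists t', In t' l' /\ Q c t'.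
Proof.
  induction l as [|a l (l' & Hl' & IH)].
  - exists nil. split; [reflexivity | intros c t []].
  - destruct (classic (exists t, Q a t)) as [(t & Ht) | Hn].
    + exists (t :: l'). split; [simpl; lia|].
      intros c t' [<- | Hc] Hq; [exists t; split; [now left | exact Ht]|].
      destruct (IH c t' Hc Hq) as (t'' & Hin & Hq'').
      exists t''. split; [now right | exact Hq''].
    + exists l'. split; [simpl; lia|].
      intros c t' [<- | Hc] Hq; [|exact (IH c t' Hc Hq)].
      exfalso. apply Hn. now exists t'.
Qed.

(* The point [x] attached to [eta] in the introduction, here called [z]. *)
Definition marks {X : Type} (d : X -> X -> R) (b : X -> R) (eta0 : boundary d)
  (k L lo hi : R) (eta : boundary d) (z : X) : Prop :=
  exists s t0 A, line_from_to d eta0 eta s /\ (forall u, A <= b (s u)) /\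
    b (s t0) <= A + k /\ lo <= A <= hi /\ z = s (t0 + L).

(** * Marked points: mutual distance, and lines between their boundary points *)

Section Marks.
Variables (X : Type) (d : X -> X -> R) (b : X -> R) (delta : R).
Hypotheses (Hm : is_metric d) (Hdelta : 0 <= delta)
  (Hlip : forall x y, b x <= b y + d x y)
  (Hhyp : forall M x y z, M <= horo_product X d b x z -> M <= horo_product X d b z y ->
     M - delta <= horo_product X d b x y).
Variables (eta0 : boundary d) (k L lo hi : R).
Hypothesis (HL : 0 <= L).

(** The reversed lines share the end [eta0], so the near-minimal points have product at least
    [lo - 6 * delta - k]. Their heights are at most [hi + k], which bounds their distance; moving on
    to [z] and [z'] adds [2 * L]. *)
Lemma marks_bounded (eta eta' : boundary d) (z z' : X) :
  marks d b eta0 k L lo hi eta z -> marks d b eta0 k L lo hi eta' z' ->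
  d z z' <= 2 * (hi - lo) + 12 * delta + 4 * k + 2 * L.
Proof.
  assert (Hm' := Hm). destruct Hm' as (_ & _ & _ & Htri).
  intros (s & t0 & A & (Hs & He0 & He) & HA & H0 & HAb & ->)
    (s' & t0' & A' & (Hs' & He0' & He') & HA' & H0' & HAb' & ->).
  assert (H := horo_product_near_min X d b delta Hm Hdelta Hlip Hhyp
    (fun t => s (- t)) (fun t => s' (- t)) A A' lo k (- t0) (- t0')
    (line_reverse X d s Hs) (line_reverse X d s' Hs')
    (boundary_asymptotic X d Hm eta0 _ _ He0 He0')).
  cbv beta in H. rewrite !Ropp_involutive in H.
  specialize (H (fun u => HA (- u)) H0 (fun u => HA' (- u)) H0'
    (proj1 HAb) (proj1 HAb')).
  unfold horo_product in H.
  assert (H1 := Htri (s (t0 + L)) (s t0) (s' (t0' + L))).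
  assert (H2 := Htri (s t0) (s' t0') (s' (t0' + L))).
  rewrite Hs, Rabs_pos_eq in H1 by lra. rewrite Hs', Rabs_left1 in H2 by lra.
  lra.
Qed.

Lemma marks_close_line_high (eta eta' : boundary d) (z z' : X) (w : R -> X) (r u : R) :
  marks d b eta0 k L lo hi eta z -> marks d b eta0 k L lo hi eta' z' ->
  0 <= r -> d z z' <= 2 * r -> line_from_to d eta eta' w ->
  lo + L - 7 * delta - k - r <= b (w u).
Proof.
  intros (s & t0 & A & (Hs & He0 & He) & HA & H0 & HAb & ->)
    (s' & t0' & A' & (Hs' & He0' & He') & HA' & H0' & HAb' & ->) Hr Hd (Hw & Hw1 & Hw2).
  exact (line_between_high X d b delta Hm Hdelta Hlip Hhyp s s' w A A' lo k t0 t0' L r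
    Hs Hs' Hw (boundary_asymptotic X d Hm eta _ _ He Hw1)
    (boundary_asymptotic X d Hm eta' _ _ He' Hw2)
    HA H0 HA' H0' (proj1 HAb) (proj1 HAb') HL Hr Hd u).
Qed.

End Marks.

(** * Covering a ball of the parabolic visual metric *)

Theorem theorem5p5 (X : Type) (d : X -> X -> R) (delta : R) :
  is_metric d -> proper_space d -> geodesic_space d -> hyperbolic d delta ->
  bounded_growth_some_scale d ->
  forall (xi : boundary d) (p : X) (eps : R), 0 < eps ->
  forall dv : punct_boundary d xi -> punct_boundary d xi -> R,
    parabolic_visual_metric d xi p eps dv ->
    doubling dv.
Proof.
  intros Hm _ Hgeo Hhyp Hbg xi p eps Heps dv Hdv.
  assert (Hdm := Hdv). destruct Hdm as ((Hvpos & Hvid & Hvsym & Hvtri) & _).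
  (* Two distinct points have finite height, which yields a ray from [p] to [xi]; otherwise a single
     ball suffices. *)
  destruct (classic (exists a c : punct_boundary d xi, a <> c)) as [Htwo | Hone].
  2: { exists 1%nat. intros x rho Hrho. exists (x :: nil). split; [simpl; lia|].
       intros y _. exists x. split; [now left|].
       destruct (classic (x = y)) as [<- | Hxy].
       - rewrite (proj2 (Hvid x x) eq_refl). lra.
       - exfalso. apply Hone. now exists x, y. }
  assert (Hray : exists g, ray_from_to d p xi g).
  { destruct Htwo as (a & c & Hac).
    destruct (visual_metric_Hxp d xi p eps dv a c Hdv Hac) as (H & HH & _).
    destruct (Hxp_near_min d xi p _ _ H 1 HH ltac:(lra)) as (s & t & B & _ & HB & _).
    exact (busemann_finite_ray d xi p (s t) B HB). }
  destruct Hray as (g & Hg).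
  assert (Hd0 := hyperbolic_nonneg X d delta Hm Hhyp p).
  assert (Hbus := fun x => busemann_bounds X d delta Hm Hhyp xi p x g Hg).
  assert (Hlip := fun x y => ray_busemann_lipschitz X d Hm g x y (proj1 Hg)).
  assert (Hhor := fun M x y z =>
    ray_busemann_hyperbolic X d delta Hm Hhyp g M x y z (proj1 Hg)).
  revert Hbus Hlip Hhor. generalize (ray_busemann X d g) as b. intros b Hbus Hlip Hhor.
  destruct (bounded_growth_all_radii X d Hm Hgeo Hbg) as (r & Hr & Hcov).
  (* adding [c0] to a height divides [exp (- eps * _)] by [2] *)
  set (c0 := ln 2 / eps).
  assert (Hec0 : eps * c0 = ln 2) by (unfold c0; field; lra).
  assert (Hc0 : 0 < c0).
  { unfold c0. apply Rdiv_lt_0_compat; [|exact Heps]. assert (H := ln_lt_2). lra. }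
  (* The [1] is the tolerance in choosing a near-minimal point; [4 * delta] is the gap between
     [busemann] and [b]. *)
  set (k := 1 + 4 * delta).
  (* Solves [lo + L - 7 * delta - k - r = h + c0 + 1] for [lo = h - c0 - 4 * delta]. *)
  set (L := 2 * c0 + 11 * delta + k + r + 1).
  assert (HL : 0 <= L) by (unfold L, k; lra).
  (* The bound of [marks_bounded] for [hi - lo = 2 * c0], plus [1] for a strict inequality. It is
     fixed before [x0] and [rho], so [N] is uniform. *)
  destruct (Hcov (4 * c0 + 12 * delta + 4 * k + 2 * L + 1)) as (N & HN).
  (* The extra centre is [x0], for the points within [rho / 2] of it. *)
  exists (S N). intros x0 rho Hrho.
  set (h := - ln rho / eps).
  assert (Heh : - eps * h = ln rho) by (unfold h; field; lra).
  assert (Hdouble : exp (- eps * (h - c0)) = 2 * rho).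
  { replace (- eps * (h - c0)) with (ln 2 + ln rho) by (rewrite <- Hec0, <- Heh; ring).
    rewrite exp_plus, !exp_ln; lra. }
  assert (Hhalf : exp (- eps * (h + c0)) = rho / 2).
  { replace (- eps * (h + c0)) with (- ln 2 + ln rho)
      by (rewrite <- Hec0, <- Heh; ring).
    rewrite exp_plus, exp_Ropp, !exp_ln; lra. }
  assert (Hsmall : forall a c H, Hxp d xi p (proj1_sig a) (proj1_sig c) = Finite H ->
    a <> c -> h + c0 < H -> dv a c < rho / 2).
  { intros a c H HH Hac Hlt.
    destruct (visual_metric_Hxp d xi p eps dv a c Hdv Hac) as (H' & HH' & _ & Hle).
    rewrite HH in HH'. injection HH' as <-.
    apply Rle_lt_trans with (1 := Hle). rewrite <- Hhalf. apply exp_increasing. nra. }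
  (* Points between the two radii have height [H] from [h - c0] to [h + c0], and [H - 4 * delta]
     bounds [b] from below on their lines to [x0]. *)
  set (P := marks d b (proj1_sig x0) k L (h - c0 - 4 * delta) (h + c0 - 4 * delta)).
  assert (Hmark : forall y, dv x0 y < rho ->
    dv x0 y < rho / 2 \/ exists z, P (proj1_sig y) z).
  { intros y Hy.
    destruct (classic (x0 = y)) as [<- | Hne].
    { left. rewrite (proj2 (Hvid x0 x0) eq_refl). lra. }
    destruct (visual_metric_Hxp d xi p eps dv x0 y Hdv Hne) as (H & HH & Hle & _).
    destruct (Rlt_or_le (h + c0) H) as [Hlt | Hge].
    { left. exact (Hsmall x0 y H HH Hne Hlt). }
    right.
    assert (Hlow : h - c0 < H).
    { assert (Hexp : exp (- eps * H) < exp (- eps * (h - c0))) by lra.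
      apply exp_lt_inv in Hexp. nra. }
    destruct (Hxp_near_min d xi p _ _ H 1 HH ltac:(lra)) as (s & t0 & B & Hs & HB & HBH).
    exists (s (t0 + L)), s, t0, (H - 4 * delta). repeat split; try lra; try apply Hs.
    - intros u. destruct (Hbus (s u)) as (B' & HB' & Hb').
      assert (Hle' := Hxp_le d xi p _ _ H B' u s HH Hs HB'). lra.
    - destruct (Hbus (s t0)) as (B' & HB' & Hb').
      rewrite HB in HB'. injection HB' as <-. unfold k. lra. }
  assert (Hclose : forall y y' z z', P (proj1_sig y) z -> P (proj1_sig y') z' ->
    d z z' <= 2 * r -> dv y y' < rho / 2).
  { intros y y' z z' Hz Hz' Hzz.
    destruct (classic (y = y')) as [<- | Hne].
    { rewrite (proj2 (Hvid y y) eq_refl). lra. }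
    destruct (visual_metric_Hxp d xi p eps dv y y' Hdv Hne) as (H & HH & _).
    apply (Hsmall y y' H HH Hne).
    apply Rlt_le_trans with (h + c0 + 1); [lra|].
    apply (Hxp_ge d xi p _ _ H _ HH). intros w u B Hw HB.
    assert (Hhigh := marks_close_line_high X d b delta Hm Hd0 Hlip Hhor _ k L _ _ HL
      _ _ z z' w r u Hz Hz' ltac:(lra) Hzz Hw).
    destruct (Hbus (w u)) as (B' & HB' & Hb').
    rewrite HB in HB'. injection HB' as <-. unfold L in Hhigh. lra. }
  destruct (classic (exists y z, P (proj1_sig (y : punct_boundary d xi)) z))
    as [(y1 & z1 & H1) | Hn].
  2: { exists (x0 :: nil). split; [simpl; lia|]. intros y Hy. exists x0.
       split; [now left|]. destruct (Hmark y Hy) as [Hh | (z & Hz)]; [exact Hh|].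
       exfalso. apply Hn. now exists y, z. }
  (* Any one mark can serve as the centre, since all marks lie within the chosen radius of it. *)
  destruct (HN z1) as (l & Hl & Hlc).
  destruct (select_witnesses (fun (c : X) (y : punct_boundary d xi) =>
    exists z, P (proj1_sig y) z /\ d c z < r) l) as (l' & Hl' & Hsel).
  exists (x0 :: l'). split; [simpl; lia|]. intros y Hy.
  destruct (Hmark y Hy) as [Hh | (z & Hz)].
  { exists x0. split; [now left | exact Hh]. }
  assert (Hzb := marks_bounded X d b delta Hm Hd0 Hlip Hhor _ k L _ _ HL _ _ z1 z H1 Hz).
  destruct (Hlc z) as (c & Hc & Hcz); [lra|].
  destruct (Hsel c y Hc) as (y' & Hin & z' & Hz' & Hcz'); [now exists z|].
  exists y'. split; [now right|].
  (* Both marks are within [r] of the same centre [c]. *)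
  apply (Hclose y' y z' z Hz' Hz).
  destruct Hm as (_ & _ & Hsym & Htri).
  assert (Ht := Htri z' c z). rewrite (Hsym z' c) in Ht. lra.
Qed.
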